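(* Let $b=2n+1\ge3$ and let $P(b)$ be the least positive integer with $2^{P(b)}\equiv\pm1\pmod b$. Build the system $IcoS(b)$ as follows. - Seeds: $a(b,1)=1$, and $a(b,i+1)$ is the smallest odd element of $RRS^*(b)$ that has not occurred as a $\hat j$ in any of the periods with seeds $a(b,1),\dots,a(b,i)$. - For seed $a=a(b,i)$, the period $IcoS(b,i)$ consists of the terms $R^{[k]}(2,2\cos(\pi a/b))=2\cos(\pi a2^k/b)$ for $k=1,\dots,P(b)$. Each term is written as $\pm2\cos(\pi\hat j/b)$ with $\hat j=\mathrm{mod}^*(a2^k,b)\in RRS^*(b)$. - Seeds are added until every element of $RRS^*(b)$ has occurred. Then $IcoS(b)$ consists of exactly $\varphi(b)/(2P(b))$ pairwise disjoint periods, each of length $P(b)$. Each $\hat j\in RRS^*(b)$ occurs exactly once among the terms $\pm2\cos(\pi\hat j/b)$ of all these periods.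
   Context: - $RRS^*(b)=\{r\in\mathbb Z:1\le r\le(b-1)/2,\ \gcd(r,b)=1\}$. - For $m$ coprime to $b$, $\mathrm{mod}^*(m,b)=\mathrm{mod}(m,b)$ if the least non-negative residue $\mathrm{mod}(m,b)$ is $\le b/2$, and $\mathrm{mod}^*(m,b)=\mathrm{mod}(-m,b)$ otherwise. - $R(2,x)=x^2-2$ and $R^{[k]}$ is its $k$-fold iterate. - $\varphi$ is Euler's totient function. *)

(* Defs.v *)
From HB Require Import structures.
From mathcomp Require Import all_boot all_order all_algebra.
From mathcomp Require Import all_classical all_reals all_analysis.
From mathcomp Require cyclic.

Set Implicit Arguments.
Unset Strict Implicit.
Unset Printing Implicit Defensive.

Import Order.TTheory GRing.Theory Num.Theory.

Local Open Scope ring_scope.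

Definition RRSstar (b : nat) : pred nat :=
  [pred r : nat | [&& 1 <= r, r <= (b - 1) %/ 2 & coprime r b]%N].

Definition lnres (m : int) (b : nat) : nat := `|(m %% b%:Z)%Z|%N.

Definition modstar (m : int) (b : nat) : nat :=
  if (2 * lnres m b <= b)%N then lnres m b else lnres (- m) b.

Definition pow2_pm1 (b k : nat) : bool :=
  ((2%:Z ^+ k == 1 %[mod b%:Z])%Z || (2%:Z ^+ k == -1 %[mod b%:Z])%Z).

(* The guard [odd b] only serves to make [Pmin] below a total function of b. *)
Lemma Pmin_exists (b : nat) :
  exists k : nat, (0 < k)%N && (odd b ==> pow2_pm1 b k).
Proof.
have [ob|_] := boolP (odd b); last by exists 1%N.
exists (totient b); rewrite totient_gt0 odd_gt0 //= /pow2_pm1.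
have co : coprime 2 b by rewrite coprime2n.
by rewrite -[2%:Z]natz -natrX natz !modz_nat cyclic.Euler_exp_totient ?eqxx.
Qed.

(* For odd b: the least k > 0 with 2 ^ k = 1 or -1 modulo b. *)
Definition Pmin (b : nat) : nat := ex_minn (Pmin_exists b).

Definition R2 {R : realType} (x : R) : R := x ^+ 2 - 2.

Definition icos_term (R : realType) (b a k : nat) : R :=
  iter k R2 (2 * cos (pi * a%:R / b%:R)).

Definition icos_period (R : realType) (b a : nat) : seq R :=
  [seq icos_term R b a k | k <- iota 1 (Pmin b)].

Definition jhat (b a k : nat) : nat := modstar (a * 2 ^ k)%N%:Z b.

Definition jhats (b a : nat) : seq nat :=
  [seq jhat b a k | k <- iota 1 (Pmin b)].

Definition occurred (b : nat) (s : seq nat) : seq nat :=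
  flatten [seq jhats b a | a <- s].

Definition all_occurred (b : nat) (s : seq nat) : Prop :=
  {subset RRSstar b <= occurred b s}.

Definition fresh_odd (b : nat) (s : seq nat) (a : nat) : bool :=
  [&& odd a, a \in RRSstar b & a \notin occurred b s].

Definition next_seed (b : nat) (s : seq nat) (a : nat) : Prop :=
  fresh_odd b s a /\ forall a' : nat, fresh_odd b s a' -> (a <= a')%N.

(* The lists a(b,1), ..., a(b,i) reached by the construction, which stops as
   soon as every element of [RRSstar b] has occurred. *)
Inductive seeds (b : nat) : seq nat -> Prop :=
| seeds_first : seeds b [:: 1%N]
| seeds_next (s : seq nat) (a : nat) :
    seeds b s -> ~ all_occurred b s -> next_seed b s a -> seeds b (rcons s a).

Definition IcoS_seeds (b : nat) (s : seq nat) : Prop :=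
  seeds b s /\ all_occurred b s.

Definition IcoS (R : realType) (b : nat) (s : seq nat) : seq (seq R) :=
  [seq icos_period R b a | a <- s].

(* Main.v *)
Require Import Defs.
From HB Require Import structures.
From mathcomp Require Import all_boot all_order all_algebra.
From mathcomp Require Import all_classical all_reals all_analysis.
From mathcomp Require Import zify ring lra.

Set Implicit Arguments.
Unset Strict Implicit.
Unset Printing Implicit Defensive.

Import Order.TTheory GRing.Theory Num.Theory.

Local Open Scope ring_scope.

(** Up to sign, 2 cos (pi m / b) depends only on the class of m modulo b and
    sign, and RRSstar b is a set of representatives of the units modulo b up to
    sign. Doubling permutes these classes in cycles that all have length
    [Pmin b], namely the cosets of the subgroup generated by 2; a period is one
    such cycle. Hence the periods partition the [totient b / 2] classes. A seed
    is available as long as some class is unused: the odd part of an unused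
    element is unused too. For the real terms, the absolute value recovers the
    class, since the cosine is positive and injective on ]0, pi/2[. *)

(** * Congruence modulo [b] up to sign *)

Definition eqpm (b : nat) (x y : int) : bool :=
  (b%:Z %| x - y)%Z || (b%:Z %| x + y)%Z.

Lemma eqpm_sym b x y : eqpm b x y = eqpm b y x.
Proof. by rewrite /eqpm -(opprB y) rpredN [x + y]addrC. Qed.

Lemma eqpm_trans b y x z : eqpm b x y -> eqpm b y z -> eqpm b x z.
Proof.
rewrite /eqpm => /orP[xy|xy] /orP[yz|yz]; apply/orP.
- by left; rewrite (_ : x - z = x - y + (y - z)); [exact: rpredD | ring].
- by right; rewrite (_ : x + z = x - y + (y + z)); [exact: rpredD | ring].
- by right; rewrite (_ : x + z = x + y - (y - z)); [exact: rpredB | ring].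
- by left; rewrite (_ : x - z = x + y - (y + z)); [exact: rpredB | ring].
Qed.

Lemma eqpm_mul2l b c x y : eqpm b x y -> eqpm b (c * x) (c * y).
Proof.
rewrite /eqpm -mulrBr -mulrDr => /orP[] h; apply/orP.
  by left; exact: dvdz_mull.
by right; exact: dvdz_mull.
Qed.

Lemma eqpm_mul2lE b c x y :
  coprimez b%:Z c -> eqpm b (c * x) (c * y) = eqpm b x y.
Proof. by move=> co; rewrite /eqpm -mulrBr -mulrDr !Gauss_dvdzr. Qed.

Lemma pow2_pm1E b k : pow2_pm1 b k = eqpm b (2 ^+ k) 1.
Proof. by rewrite /pow2_pm1 !eqz_mod_dvd opprK. Qed.

(** Both numbers lie in [1, (b-1)/2], so |r - r'| < b and 0 < r + r' < b: the sum is never a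
    multiple of [b], the difference only when it vanishes. *)
Lemma RRSstar_inj b r r' : r \in RRSstar b -> r' \in RRSstar b ->
  eqpm b r%:Z r'%:Z -> r = r'.
Proof.
rewrite !inE => /and3P[r1 rb _] /and3P[r'1 r'b _] /orP[]/dvdzP[q hq].
  have q0 : q = 0 by nia.
  by nia.
by exfalso; have [q0|q0|q0] := ltrgtP q 0; nia.
Qed.

(** * Least residues and canonical representatives *)

Lemma lnresE m b : (0 < b)%N -> (lnres m b)%:Z = (m %% b%:Z)%Z.
Proof. by move=> b0; rewrite /lnres abszE ger0_norm // modz_ge0 //; lia. Qed.

Lemma eqpm_lnres m b : (0 < b)%N -> eqpm b (lnres m b)%:Z m.
Proof.
move=> b0; rewrite lnresE // /eqpm; apply/orP; left; apply/dvdzP.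
by exists (- (m %/ b%:Z)%Z); rewrite {2}(divz_eq m b%:Z); ring.
Qed.

Lemma eqpm_modstar m b : (0 < b)%N -> eqpm b (modstar m b)%:Z m.
Proof.
move=> b0; rewrite /modstar; case: ifP => _; first exact: eqpm_lnres.
by have := eqpm_lnres (- m) b0; rewrite /eqpm opprK orbC.
Qed.

Lemma eqpm_coprime b x y : eqpm b x y -> coprimez b%:Z x -> coprimez b%:Z y.
Proof.
move=> /orP[]/dvdzP[q hq].
  rewrite (_ : x = q * b%:Z + y); last by rewrite -hq; ring.
  by rewrite /coprimez gcdzMDl.
rewrite (_ : x = q * b%:Z + - y); last by rewrite -hq; ring.
by rewrite /coprimez gcdzMDl gcdzN.
Qed.

(** The residues of [m] and [- m] add up to [b], so one of them lies below b/2; oddness of [b]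
    sharpens this to (b-1)/2. *)
Lemma modstar_in m b : (1 < b)%N -> odd b -> coprimez b%:Z m ->
  modstar m b \in RRSstar b.
Proof.
move=> b1 ob co; have b0 : (0 < b)%N by lia.
have e := eqpm_modstar m b0; rewrite eqpm_sym in e.
have := eqpm_coprime e co; rewrite coprimezE !absz_nat coprime_sym => cs.
rewrite inE cs andbT; apply/andP; split.
  by rewrite lt0n; apply/eqP => z; move: cs; rewrite z /coprime gcd0n; lia.
rewrite /modstar; case: ifP => h; first by lia.
have d0 := divz_eq m b%:Z; have d1 := divz_eq (- m) b%:Z.
have l0 := lnresE m b0; have l1 := lnresE (- m) b0.
have bz : (0 < b%:Z) by lia.
have u0 := ltz_pmod m bz; have u1 := ltz_pmod (- m) bz.
have bn : b%:Z != 0 by lia.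
have v0 := modz_ge0 m bn; have v1 := modz_ge0 (- m) bn.
rewrite -l0 -l1 in d0 d1 u0 u1.
move: (m %/ b%:Z)%Z (- m %/ b%:Z)%Z d0 d1 => q q' d0 d1.
have s : (lnres m b)%:Z + (lnres (- m) b)%:Z = - (q + q') * b%:Z by lia.
(* The sum of the two residues is a multiple of [b] strictly between 0 and 2b, hence [b] itself. *)
have : - (q + q') = 1 by nia.
by lia.
Qed.

Lemma modstar_eq m m' b : (1 < b)%N -> odd b ->
  coprimez b%:Z m -> coprimez b%:Z m' ->
  (modstar m b == modstar m' b) = eqpm b m m'.
Proof.
move=> b1 ob co co'; have b0 : (0 < b)%N by lia.
have e := eqpm_modstar m b0; have e' := eqpm_modstar m' b0.
apply/eqP/idP => [E|E].
  by rewrite E eqpm_sym in e; exact: eqpm_trans e e'.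
apply: RRSstar_inj (modstar_in b1 ob co) (modstar_in b1 ob co') _.
by apply: eqpm_trans e (eqpm_trans E _); rewrite eqpm_sym.
Qed.

Lemma modstar_id r b : (1 < b)%N -> odd b -> r \in RRSstar b ->
  modstar r%:Z b = r.
Proof.
move=> b1 ob r_in; move: (r_in); rewrite inE => /and3P[_ _ co].
apply: RRSstar_inj (modstar_in b1 ob _) r_in _; last by apply: eqpm_modstar; lia.
by rewrite coprimezE !absz_nat coprime_sym.
Qed.

(** * The order of 2 up to sign *)

Lemma Pmin_gt0 b : (0 < Pmin b)%N.
Proof. by rewrite /Pmin; case: ex_minnP => k /andP[]. Qed.

Lemma eqpm_Pmin b : odd b -> eqpm b (2 ^+ Pmin b) 1.
Proof.
by move=> ob; rewrite /Pmin; case: ex_minnP => k /andP[_]; rewrite ob pow2_pm1E.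
Qed.

Lemma Pmin_le b k : (0 < k)%N -> eqpm b (2 ^+ k) 1 -> (Pmin b <= k)%N.
Proof.
move=> k0 e; rewrite /Pmin; case: ex_minnP => m _; apply.
by rewrite k0 pow2_pm1E e implybT.
Qed.

(** Serves the reflection r -> b - r in the totient count. *)
Lemma coprimenB m n : (m <= n)%N -> coprime n (n - m) = coprime n m.
Proof.
move=> /subnK; move: (n - m)%N => k <-.
by rewrite /coprime ![gcdn (k + m) _]gcdnC gcdnDl gcdnDr gcdnC.
Qed.

(** * Orbits of doubling on classes up to sign *)

Section Jhat.
Variable b : nat.
Hypotheses (b_gt1 : (1 < b)%N) (odd_b : odd b).

Lemma coprimez_pow2 a k : coprime a b -> coprimez b%:Z (a * 2 ^ k)%N%:Z.
Proof.
move=> co; rewrite coprimezE !absz_nat coprimeMr coprime_sym co /=.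
by rewrite coprimeXr // coprimen2.
Qed.

Lemma coprimez_exp2 k : coprimez b%:Z (2 ^+ k).
Proof. by apply: coprimezXr; rewrite coprimezE /= coprimen2. Qed.

Lemma jhat_in a k : coprime a b -> jhat b a k \in RRSstar b.
Proof. by move=> co; apply: modstar_in => //; apply: coprimez_pow2. Qed.

Lemma jhat_eq a a' k k' : coprime a b -> coprime a' b ->
  (jhat b a k == jhat b a' k') = eqpm b (2 ^+ k * a%:Z) (2 ^+ k' * a'%:Z).
Proof.
move=> co co'; rewrite /jhat modstar_eq ?coprimez_pow2 //.
by rewrite -!natz !natrM !natrX ![_ * 2 ^+ _]mulrC.
Qed.

(** The factor 2^d is a unit modulo the odd [b], so it cancels. *)
Lemma jhatD a a' k k' d : coprime a b -> coprime a' b ->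
  (jhat b a (d + k) == jhat b a' (d + k')) = (jhat b a k == jhat b a' k').
Proof.
by move=> co co'; rewrite !jhat_eq // !exprD -!mulrA eqpm_mul2lE ?coprimez_exp2.
Qed.

Lemma jhatDPmin a k : coprime a b -> jhat b a (k + Pmin b) = jhat b a k.
Proof.
move=> co; apply/eqP; rewrite -{2}[k]addn0 jhatD // jhat_eq // expr0 mulrC.
rewrite [1 * _]mulrC; apply: eqpm_mul2l; exact: eqpm_Pmin.
Qed.

Lemma jhat0 a : a \in RRSstar b -> jhat b a 0 = a.
Proof. by move=> a_in; rewrite /jhat expn0 muln1 modstar_id. Qed.

Lemma size_jhats a : size (jhats b a) = Pmin b.
Proof. by rewrite size_map size_iota. Qed.

(** Periodicity brings any exponent back into the window 1, ..., [Pmin b]. *)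
Lemma mem_jhats a k : coprime a b -> jhat b a k \in jhats b a.
Proof.
move=> co; have P0 := Pmin_gt0 b.
elim/ltn_ind: k => k IH; have [kP|kP] := ltnP (Pmin b) k.
  by rewrite -(@subnK (Pmin b) k) 1?ltnW // jhatDPmin // IH //; lia.
have [->|k0] := posnP k.
  (* Exponent 0 lies outside the window and is replaced by [Pmin b]. *)
  by rewrite -jhatDPmin // map_f // mem_iota; lia.
by rewrite map_f // mem_iota; lia.
Qed.

(** A repetition at exponents k < l would give 2^(l-k) = 1 or -1 modulo [b] with 0 < l - k <
    [Pmin b], against minimality. *)
Lemma jhats_uniq a : coprime a b -> uniq (jhats b a).
Proof.
move=> co; rewrite map_inj_in_uniq ?iota_uniq //.
move=> k l; wlog kl : k l / (k <= l)%N.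
  by case: (leqP k l) => [|/ltnW] kl h hk hl E; [|apply: esym]; apply: h.
rewrite !mem_iota => hk hl /esym E.
have [->//|ne] := eqVneq k l; exfalso.
have : jhat b a (k + (l - k)) == jhat b a (k + 0) by rewrite addn0 subnKC // E.
rewrite jhatD // jhat_eq // [2 ^+ _ * _]mulrC [2 ^+ 0 * _]mulrC.
rewrite eqpm_mul2lE ?expr0; last by rewrite coprimezE !absz_nat coprime_sym.
by move/Pmin_le => /(_ ltac:(lia)); lia.
Qed.

Lemma jhats_sub a : coprime a b -> {subset jhats b a <= RRSstar b}.
Proof. by move=> co _ /mapP[k _ ->]; apply: jhat_in. Qed.

(** Orbits are cyclic: further doubling leads from any term of the orbit of [a] back to [a], without
    leaving the period of [a']. *)
Lemma jhats_meet a a' k : a \in RRSstar b -> coprime a' b ->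
  jhat b a k \in jhats b a' -> a \in jhats b a'.
Proof.
move=> a_in co' /mapP[k' _] /eqP.
have co : coprime a b by move: a_in; rewrite inE => /and3P[].
(* The shift raises the exponent [k] to a multiple of [Pmin b], where the orbit is back at [a]. *)
rewrite -(jhatD k k' (k * Pmin b - k)%N) // subnK; last first.
  by rewrite leq_pmulr // Pmin_gt0.
have -> : jhat b a (k * Pmin b) = a.
  elim: k => [|k IH]; first exact: jhat0.
  by rewrite mulSn addnC jhatDPmin.
by move/eqP->; exact: mem_jhats.
Qed.

(** * The construction of the seeds: invariant, existence, uniqueness *)

Lemma mem_occurredP s j : reflect (exists2 a, a \in s & j \in jhats b a)
  (j \in occurred b s).
Proof.
apply: (iffP flattenP) => [[_ /mapP[a a_in ->] ?]|[a a_in ?]]; first by exists a.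
by exists (jhats b a) => //; apply: map_f.
Qed.

Lemma occurred_rcons s a : occurred b (rcons s a) = occurred b s ++ jhats b a.
Proof. by rewrite /occurred map_rcons flatten_rcons. Qed.

Lemma size_occurred s : size (occurred b s) = (size s * Pmin b)%N.
Proof.
rewrite /occurred; elim: s => //= a s IH.
by rewrite size_cat IH size_jhats mulSn.
Qed.

Lemma occurred_sub s : all (coprime^~ b) s -> {subset occurred b s <= RRSstar b}.
Proof.
by move/allP=> cos j /mem_occurredP[a /cos co]; apply: jhats_sub.
Qed.

Lemma seeds_spec s : seeds b s ->
  [/\ s != [::], all (fun a => a \in RRSstar b) s & uniq (occurred b s)].
Proof.
elim=> [|{}s a _ [s0 s_in Us] _ [/and3P[_ a_in a_new] _]].
  split=> //; first by rewrite /= inE coprime1n; lia.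
  by rewrite /occurred /= cats0 jhats_uniq // coprime1n.
have co : coprime a b by move: a_in; rewrite inE => /and3P[].
rewrite all_rcons a_in s_in occurred_rcons cat_uniq Us jhats_uniq //=.
split=> //; first by case: (s).
(* If the new period met an earlier one, the new seed would already have occurred there. *)
rewrite andbT; apply/hasPn => _ /mapP[k _ ->].
apply: contra a_new => /mem_occurredP[a' a's hk].
apply/mem_occurredP; exists a' => //; apply: jhats_meet hk => //.
by move/allP/(_ _ a's): s_in; rewrite inE => /and3P[].
Qed.

Lemma RRSstar_coprime s :
  all (fun a => a \in RRSstar b) s -> all (coprime^~ b) s.
Proof. by apply: sub_all => a; rewrite inE => /and3P[]. Qed.

(* The odd part of an unused element is unused, because the occurred elements
   are stable under doubling. *)
Lemma next_seed_exists s : all (coprime^~ b) s -> ~ all_occurred b s ->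
  exists a, next_seed b s a.
Proof.
move=> s_co nall.
have ex : exists a, fresh_odd b s a.
  apply: contrapT => none; apply: nall => r r_in.
  apply: contrapT => /negP r_new; apply: none.
  move: r_in (r_in); rewrite {1}inE => /and3P[r1 rb rc] r_in.
  have [|m om E] := @pfactor_coprime 2 r isT; first by lia.
  have m1 : (0 < m)%N by move: r1; rewrite E muln_gt0 => /andP[].
  have mr : (m <= r)%N by rewrite E leq_pmulr // expn_gt0.
  have mc : coprime m b by move: rc; rewrite E coprimeMl => /andP[].
  exists m; rewrite /fresh_odd -coprime2n om inE m1 mc (leq_trans mr) //=.
  apply: contra r_new => /mem_occurredP[a a_s /mapP[k _ Ek]].
  have a_co : coprime a b by move/allP: s_co; apply.
  apply/mem_occurredP; exists a => //.
  have m_in : m \in RRSstar b by rewrite inE m1 mc (leq_trans mr).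
  have : jhat b m 0 == jhat b a k by rewrite jhat0 // Ek.
  rewrite -(jhatD 0 k (logn 2 r)) // addn0.
  suff -> : jhat b m (logn 2 r) = r by move/eqP->; exact: mem_jhats.
  by rewrite /jhat -E modstar_id.
exists (ex_minn ex); split; first by case: ex_minnP.
by case: ex_minnP => m _ mmin a'; apply: mmin.
Qed.

Lemma next_seed_uniq s a a' : next_seed b s a -> next_seed b s a' -> a = a'.
Proof. by move=> [fa ma] [fa' ma']; apply/eqP; rewrite eqn_leq ma // ma'. Qed.

(** A seed is added only while some element is missing, so no proper prefix is a stopping point. *)
Lemma seeds_take s k : seeds b s -> (0 < k < size s)%N ->
  seeds b (take k s) /\ ~ all_occurred b (take k s).
Proof.
move=> hs; elim: hs k => [|{}s a hs IH nall _] k; first by case: k => [|[]].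
rewrite size_rcons ltnS => /andP[k0]; rewrite leq_eqVlt => /orP[/eqP->|ks].
  by rewrite -cats1 take_size_cat.
by rewrite -cats1 take_cat ks; apply: IH; rewrite k0.
Qed.

(** The construction is deterministic, since the next seed is a minimum. *)
Lemma seeds_size_inj s s' : seeds b s -> seeds b s' -> size s = size s' -> s = s'.
Proof.
move=> hs; elim: hs s' => [|{}s a hs IH _ na] s' [|{}s' a' hs' _ na'] //.
- have [+ _ _] := seeds_spec hs'; case: s' {hs' na'} => //= x s' _.
  by rewrite size_rcons.
- have [+ _ _] := seeds_spec hs; case: (s) => //= x t _.
  by rewrite size_rcons.
- rewrite !size_rcons => -[] /(IH _ hs') E; rewrite -E in na' *.
  by rewrite (next_seed_uniq na na').
Qed.

(** If one list were shorter, it would be a proper prefix of the other, where the construction had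
    not stopped. *)
Lemma IcoS_seeds_inj s s' : IcoS_seeds b s -> IcoS_seeds b s' -> s = s'.
Proof.
wlog le : s s' / (size s <= size s')%N.
  move=> h hs hs'; case: (leqP (size s) (size s')) => [|/ltnW] le; first exact: h.
  by apply: esym; apply: h.
move=> [hs os] [hs' os']; have [] := ltnP (size s) (size s') => [lt|ge].
  have [|ht nt] := @seeds_take s' (size s) hs'.
    by rewrite lt andbT; have [+ _ _] := seeds_spec hs; case: (s).
  case: nt; rewrite -(seeds_size_inj hs ht) // size_take lt //.
by apply: seeds_size_inj => //; apply/eqP; rewrite eqn_leq le.
Qed.

(** * Counting: termination and the totient *)

Definition RRSseq := [seq r <- iota 1 ((b - 1) %/ 2) | coprime r b].

Lemma mem_RRSseq : RRSseq =i RRSstar b.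
Proof.
by move=> r; rewrite mem_filter mem_iota add1n ltnS inE andbC -andbA.
Qed.

(** Without a stop the seed list would grow forever, while its periods are disjoint, nonempty and
    contained in a finite set. *)
Lemma IcoS_seeds_exists : exists s, IcoS_seeds b s.
Proof.
apply: contrapT => none.
have grow m : exists2 s, seeds b s & size s = m.+1.
  elim: m => [|m [s hs sz]]; first by exists [:: 1%N] => //; exact: seeds_first.
  have nall : ~ all_occurred b s by move=> os; apply: none; exists s.
  have [_ s_in _] := seeds_spec hs.
  have [a na] := next_seed_exists (RRSstar_coprime s_in) nall.
  by exists (rcons s a); [exact: seeds_next | rewrite size_rcons sz].
(* One seed more than there are elements already overfills [RRSseq]. *)
have [s hs sz] := grow (size RRSseq).
have [_ s_in Us] := seeds_spec hs.
have := uniq_leq_size Us (s2 := RRSseq).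
rewrite size_occurred sz leqNgt leq_pmulr ?Pmin_gt0 // => h.
suff : false by []; apply: h => j j_in; rewrite mem_RRSseq.
by apply: occurred_sub j_in; apply: RRSstar_coprime.
Qed.

(** With b = 2n + 1, the map r -> b - r exchanges the units in 1, ..., n with those in n + 1, ...,
    2n. *)
Lemma totientE_RRSseq : totient b = (2 * size RRSseq)%N.
Proof.
have E : (b = ((b - 1) %/ 2).*2.+1)%N by lia.
set n := ((b - 1) %/ 2)%N in E.
have -> : size RRSseq = (\sum_(0 <= r < n) coprime b r.+1)%N.
  rewrite size_filter -sumn_count sumnE big_map -/n.
  rewrite (_ : iota 1 n = index_iota 1 n.+1) ?big_add1; last first.
    by rewrite /index_iota subn1.
  by apply: eq_bigr => r _; rewrite coprime_sym.
rewrite totient_count_coprime {1}E big_nat_recl // /coprime gcdn0 -/(coprime _ _).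
rewrite (_ : b == 1%N = false) ?add0n; last by lia.
rewrite (@big_cat_nat _ _ _ n) //=; last by lia.
rewrite mulSn mul1n; congr (_ + _)%N.
(* The upper half is shifted to start at 0 and then reversed, so that index [i] stands for b - (i +
   1). *)
rewrite -[X in (\sum_(X <= _ < _) _)%N]add0n big_addn -addnn addnK big_nat_rev.
apply: eq_big_nat => i /andP[_ lt_in].
rewrite (_ : (0 + n - i.+1 + n).+1 = b - i.+1)%N; last by lia.
by rewrite -/(coprime b _) -/(coprime b _) coprimenB //; lia.
Qed.

End Jhat.

Lemma uniq_flatten_disjoint (T : eqType) (ss : seq (seq T)) (i j : nat) (x : T) :
  uniq (flatten ss) -> (i < j < size ss)%N ->
  x \in nth [::] ss i -> x \notin nth [::] ss j.
Proof.
elim: ss i j => [|s ss IH] [|i] [|j] //=; rewrite cat_uniq ltnS => /and3P[_ dj U].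
  move=> j_lt x_s; apply: contra dj => x_j.
  apply/hasP; exists x => //; apply/flattenP.
  by exists (nth [::] ss j) => //; apply: mem_nth.
by move=> ij; apply: IH.
Qed.

(** * The real terms and their absolute values *)

Section Cosine.
Variables (R : realType) (b : nat).
Hypotheses (b_gt1 : (1 < b)%N) (odd_b : odd b).

Lemma cosD_natpi (x : R) n : cos (x + n%:R * pi) = (-1) ^+ n * cos x.
Proof.
elim: n => [|n IH]; first by rewrite mul0r addr0 expr0 mul1r.
by rewrite -natr1 mulrDl mul1r addrA cosDpi IH exprS mulN1r mulNr.
Qed.

Lemma cosD_intpi (x : R) (q : int) :
  exists e : bool, cos (x + q%:~R * pi) = (-1) ^+ e * cos x.
Proof.
case: q => n; first by exists (odd n); rewrite signr_odd -cosD_natpi.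
exists (odd n.+1); rewrite signr_odd NegzE mulrNz mulNr.
(* For a negative multiple, the opposite shift is applied on the right; the sign then occurs twice
   and cancels. *)
by rewrite -[in RHS](subrK (n.+1%:R * pi) x) cosD_natpi mulrA -exprD addnn
           -signr_odd odd_double mul1r.
Qed.

(** Writing x = qb + y or x = qb - y, the angles differ by q pi up to a reflection, under which the
    cosine is even. *)
Lemma cos_eqpm (x y : int) : eqpm b x y -> exists e : bool,
  cos (pi * x%:~R / b%:R) = (-1) ^+ e * cos (pi * y%:~R / b%:R) :> R.
Proof.
have b0 : b%:R != 0 :> R by rewrite pnatr_eq0; lia.
move=> /orP[]/dvdzP[q hq].
  have [e he] := cosD_intpi (pi * y%:~R / b%:R) q; exists e; rewrite -he.
  have -> : x = q * b%:Z + y by rewrite -hq; ring.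
  by rewrite intrD intrM; congr cos; field.
have [e he] := cosD_intpi (pi * (- y)%:~R / b%:R) q; exists e.
rewrite -[cos (pi * y%:~R / b%:R)]cosN -mulNr -mulrN -mulrNz -he.
have -> : x = q * b%:Z - y by rewrite -hq; ring.
by rewrite intrB intrM; congr cos; rewrite !mulrNz; field.
Qed.

(** [R2] is angle doubling: 2 cos(2t) = (2 cos t)^2 - 2. *)
Lemma icos_termE a k :
  icos_term R b a k = 2 * cos (pi * (a * 2 ^ k)%:R / b%:R).
Proof.
elim: k => [|k IH]; first by rewrite expn0 muln1.
rewrite /icos_term iterS -/(icos_term _ _ _ _) IH /R2.
have -> : pi * (a * 2 ^ k.+1)%:R / b%:R = (pi * (a * 2 ^ k)%:R / b%:R) *+ 2 :> R.
  by rewrite expnS mulnCA natrM -[RHS]mulr_natl; ring.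
by rewrite cos_mulr2n; ring.
Qed.

(** For [j] in [RRSstar b], this is the common absolute value of all terms in the class of [j]. *)
Definition cosj (j : nat) : R := 2 * cos (pi * j%:R / b%:R).

Lemma icos_term_jhat a k : exists e : bool,
  icos_term R b a k = (-1) ^+ e * cosj (jhat b a k).
Proof.
have [e he] : exists e : bool, cos (pi * (a * 2 ^ k)%N%:Z%:~R / b%:R) =
    (-1) ^+ e * cos (pi * (jhat b a k)%:Z%:~R / b%:R) :> R.
  by apply: cos_eqpm; rewrite eqpm_sym; apply: eqpm_modstar; lia.
by exists e; rewrite icos_termE /cosj he; ring.
Qed.

Lemma RRSstar_angle j : j \in RRSstar b -> 0 < (pi : R) * j%:R / b%:R < pi / 2.
Proof.
rewrite inE => /and3P[j1 jb _].
have b0 : 0 < b%:R :> R by rewrite ltr0n; lia.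
have pi0 := pi_gt0 R.
apply/andP; split; first by rewrite divr_gt0 // mulr_gt0 // ltr0n.
rewrite -mulrA ltr_pM2l // ltr_pdivrMr //.
rewrite mulrC ltr_pdivlMr // -natrM ltr_nat; lia.
Qed.

Lemma cosj_gt0 j : j \in RRSstar b -> 0 < cosj j.
Proof.
move=> /RRSstar_angle h; rewrite mulr_gt0 // cos_gt0_pihalf //.
by have := pi_gt0 R; lra.
Qed.

Lemma cosj_inj : {in RRSstar b &, injective cosj}.
Proof.
move=> i j /RRSstar_angle hi /RRSstar_angle hj.
have b0 : b%:R != 0 :> R by rewrite pnatr_eq0; lia.
have pi0 := pi_gt0 R.
move=> /(mulfI (_ : 2 != 0)) => /(_ ltac:(by rewrite pnatr_eq0)) /cos_inj.
rewrite !in_itv /= => /(_ ltac:(lra) ltac:(lra)) /(mulIf (invr_neq0 b0)).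
by move=> /(mulfI (lt0r_neq0 pi0)) /eqP; rewrite eqr_nat => /eqP.
Qed.

Lemma norm_icos_term a k : coprime a b ->
  `|icos_term R b a k| = cosj (jhat b a k).
Proof.
move=> co; have [e ->] := icos_term_jhat a k.
by rewrite normrM normr_sign mul1r ger0_norm // ltW // cosj_gt0 // jhat_in.
Qed.

Lemma norm_icos_period a : coprime a b ->
  map Num.norm (icos_period R b a) = map cosj (jhats b a).
Proof.
by move=> co; rewrite -!map_comp; apply: eq_map => k /=; apply: norm_icos_term.
Qed.

Lemma norm_IcoS s : all (coprime^~ b) s ->
  map Num.norm (flatten (IcoS R b s)) = map cosj (occurred b s).
Proof.
rewrite /occurred; elim: s => //= a s IH /andP[co cos].
by rewrite !map_cat norm_icos_period // IH.
Qed.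

(** Even the absolute values are distinct, because [cosj] is injective on [RRSstar b]. *)
Lemma uniq_IcoS s : all (coprime^~ b) s -> uniq (occurred b s) ->
  uniq (flatten (IcoS R b s)).
Proof.
move=> cos U; apply: (@map_uniq _ _ Num.norm); rewrite norm_IcoS //.
by rewrite map_inj_in_uniq // => i j hi hj; apply: cosj_inj;
   apply: occurred_sub cos _ _.
Qed.

(* The last term is the seed value up to sign, and R2 is even. *)
Lemma icos_term_Pmin a : icos_term R b a (Pmin b).+1 = icos_term R b a 1.
Proof.
have [e he] : exists e : bool, cos (pi * (a * 2 ^ Pmin b)%N%:Z%:~R / b%:R) =
    (-1) ^+ e * cos (pi * a%:Z%:~R / b%:R) :> R.
  apply: cos_eqpm; rewrite -[a in eqpm _ _ a%:Z]muln1 !PoszM.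
  by apply: eqpm_mul2l; rewrite -!natz natrX; apply: eqpm_Pmin.
rewrite {1}/icos_term iterS -/(icos_term _ _ _ _) icos_termE he.
by rewrite /icos_term /= /R2 mulrCA exprMn sqrr_sign mul1r.
Qed.

Lemma icos_period_traject a :
  icos_period R b a = traject (@R2 R) (icos_term R b a 1) (Pmin b).
Proof.
apply: (@eq_from_nth _ (icos_term R b a 1)); first by rewrite size_traject size_map size_iota.
move=> i; rewrite size_map size_iota => i_lt.
rewrite (nth_map 0%N) ?size_iota // nth_iota // nth_traject //.
by rewrite /icos_term -iterD addn1.
Qed.

Lemma icos_period_fcycle a : fcycle (@R2 R) (icos_period R b a).
Proof.
rewrite icos_period_traject.
have := icos_term_Pmin a; case: (Pmin b) (Pmin_gt0 b) => // P _ E.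
(* Closing the cycle appends the first term, which is also the image of the last one, so the closed
   list is the trajectory started one step later. *)
rewrite trajectS /= (_ : rcons _ _ = traject (@R2 R) (R2 (icos_term R b a 1)) P.+1).
  exact: fpath_traject.
rewrite trajectSr; congr rcons.
by rewrite -iterSr -[LHS]E /icos_term -iterD addn1.
Qed.

(** As [cosj j] is nonnegative, a term equals plus or minus [cosj j] exactly when its absolute value
    is [cosj j]; injectivity of [cosj] then turns this into a count of [j]. *)
Lemma count_pm_cosj s j : all (coprime^~ b) s -> j \in RRSstar b ->
  count (fun x : R => (x == cosj j) || (x == - cosj j)) (flatten (IcoS R b s))
  = count_mem j (occurred b s).
Proof.
move=> cos j_in; have c0 := ltW (cosj_gt0 j_in).
transitivity (count_mem (cosj j) (map Num.norm (flatten (IcoS R b s)))).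
  by rewrite count_map; apply: eq_count => x /=; rewrite eqr_norml c0 andbT.
rewrite norm_IcoS // count_map; apply: eq_in_count => i i_in /=.
by apply/eqP/eqP => [|->//]; apply: cosj_inj => //; apply: occurred_sub i_in.
Qed.

End Cosine.

Theorem theorem22 (R : realType) (n b : nat)
    (hb : b = (2 * n + 1)%N) (hb3 : (3 <= b)%N) :
  (exists! s : seq nat, IcoS_seeds b s) /\
  forall s : seq nat, IcoS_seeds b s ->
    [/\ forall a k : nat, a \in s -> (1 <= k <= Pmin b)%N ->
          [/\ icos_term R b a k = 2 * cos (pi * (a * 2 ^ k)%:R / b%:R),
              jhat b a k \in RRSstar b
            & exists e : bool,
                icos_term R b a k
                = (-1) ^+ e * (2 * cos (pi * (jhat b a k)%:R / b%:R))],
        (2 * Pmin b %| totient b)%N /\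
        size (IcoS R b s) = (totient b %/ (2 * Pmin b))%N,
        forall p : seq R, p \in IcoS R b s ->
          [/\ size p = Pmin b, uniq p & fcycle (@R2 R) p],
        forall i j : nat, (i < j < size (IcoS R b s))%N ->
          forall x : R, x \in nth [::] (IcoS R b s) i ->
            x \notin nth [::] (IcoS R b s) j
      & forall j : nat, j \in RRSstar b ->
          count_mem j (occurred b s) = 1%N /\
          count (fun x : R => (x == 2 * cos (pi * j%:R / b%:R)) ||
                              (x == - (2 * cos (pi * j%:R / b%:R))))
                (flatten (IcoS R b s)) = 1%N].
Proof.
have b1 : (1 < b)%N by lia.
have ob : odd b by lia.
split.
  have [s hs] := IcoS_seeds_exists b1 ob.
  by exists s; split=> // s'; apply: IcoS_seeds_inj.
move=> s [hs os]; have [_ s_in Us] := seeds_spec b1 ob hs.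
have s_co := RRSstar_coprime s_in.
(* The occurred elements form a permutation of [RRSseq]; comparing lengths gives the number of
   periods. *)
have tot : totient b = (size s * (2 * Pmin b))%N.
  rewrite mulnCA totientE_RRSseq // -size_occurred; congr (2 * _)%N.
  apply/perm_size/uniq_perm => // [|j]; first exact/filter_uniq/iota_uniq.
  rewrite mem_RRSseq; apply/idP/idP => [/os//|]; exact: occurred_sub.
split.
- move=> a k a_s _; split; first exact: icos_termE.
    by apply: jhat_in => //; apply: (allP s_co).
  exact: icos_term_jhat.
- rewrite tot dvdn_mull // mulnK; last by rewrite muln_gt0 Pmin_gt0.
  by rewrite size_map.
- move=> _ /mapP[a a_s ->]; split; last exact: icos_period_fcycle.
    by rewrite size_map size_iota.
  have a_co : coprime a b by apply: (allP s_co).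
  (* A single period is treated as the system with the one seed [a]. *)
  have := @uniq_IcoS R b b1 ob [:: a].
  by rewrite /occurred /= !cats0 a_co => /(_ isT); apply; apply: jhats_uniq.
- by move=> i j ij x; apply: uniq_flatten_disjoint ij; apply: uniq_IcoS.
- move=> j j_in; have c1 : count_mem j (occurred b s) = 1%N.
    by rewrite count_uniq_mem // (os _ j_in).
  by split=> //; rewrite count_pm_cosj.
Qed.
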